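(* Let $\Gamma$ be a finitely generated group, with finite generating set $X$, that contains a nonabelian free subgroup. Then $\max\mathrm{D}_{\Gamma,X}(n)\not\preceq\log(n)$; that is, the relation $\max\mathrm{D}_{\Gamma,X}(n)\preceq\log(n)$ does not hold.
   Context: $\|\cdot\|_X$ denotes word length with respect to $X$. For nontrivial $\gamma\in\Gamma$, let $\mathrm{D}_\Gamma(\gamma)=\min\{[\Gamma:\Delta]:\Delta\le\Gamma\text{ a finite index subgroup},\ \gamma\notin\Delta\}$ (subgroups $\Delta$ are not required to be normal; the value is $\infty$ if there is no such $\Delta$). Then $\max\mathrm{D}_{\Gamma,X}(n)$ denotes the maximum of $\mathrm{D}_\Gamma(\gamma)$ over all nontrivial $\gamma\in\Gamma$ with $\|\gamma\|_X\le n$. For functions $f_1,f_2$ on the positive integers with values in $[0,\infty]$, $f_1\preceq f_2$ means that there is a constant $C$ (a positive integer) such that $f_1(n)\le C f_2(Cn)$ for all $n\geq 1$. *)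

(* Defs.v *)
From HB Require Import structures.
From mathcomp Require Import all_boot all_order all_algebra.
From mathcomp Require Import all_classical all_reals all_analysis.

Set Implicit Arguments.
Unset Strict Implicit.
Unset Printing Implicit Defensive.

Import Order.TTheory GRing.Theory Num.Theory.

Local Open Scope classical_set_scope.
Local Open Scope group_scope.

Section Groups.
Variable G : groupType.
Implicit Types (g : G) (X B D F : set G) (w : seq (G * bool)).

Definition subgroup D : Prop := group_closed [in D].

Definition generated X : set G := smallest subgroup X.

Definition left_cosets D : set (set G) :=
  [set (fun h => g * h) @` D | g in [set: G]].

Definition has_index D (k : nat) : Prop := (left_cosets D #= `I_k)%card.

(* The letter [(x, false)] stands for [x], and [(x, true)] for [x^-1]. *)
Definition word_over X w : Prop := forall l, l \in w -> X l.1.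

Definition word_eval w : G :=
  \prod_(l <- w) (if l.2 then l.1^-1 else l.1).

Definition reduced w : bool :=
  sorted (fun l m => ~~ ((l.1 == m.1) && (l.2 != m.2))) w.

Definition free_basis B F : Prop :=
  generated B = F /\
  forall w, word_over B w -> reduced w -> w <> [::] -> word_eval w <> 1.

Definition is_free F : Prop := exists B, free_basis B F.

Definition nonabelian F : Prop :=
  exists x y, [/\ F x, F y & x * y <> y * x].

Definition contains_nonabelian_free : Prop :=
  exists F, [/\ subgroup F, is_free F & nonabelian F].

End Groups.

Local Open Scope ring_scope.
Local Open Scope ereal_scope.

Section DivisibilityFunction.
Variables (R : realType) (G : groupType).
Implicit Types (g : G) (X D : set G).

(* Equal to [+oo] outside the subgroup generated by [X]. *)
Definition word_length X g : \bar R :=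
  ereal_inf [set (size w)%:R%:E | w in
    [set w | word_over X w /\ word_eval w = g]].

(* An infimum over a set of natural numbers, hence a minimum, or [+oo] if the
   set is empty. *)
Definition divisibility g : \bar R :=
  ereal_inf [set k%:R%:E | k in
    [set k : nat | exists D, [/\ subgroup D, has_index D k & ~ D g]]].

(* If [X] is finite, there are finitely many [g] to consider, so that this
   supremum is a maximum as soon as some nontrivial [g] has length at most
   [n]; otherwise it is [-oo]. The latter does not occur for [n >= 1] if [X]
   generates a nontrivial group. *)
Definition max_divisibility X (n : nat) : \bar R :=
  ereal_sup [set divisibility g | g in
    [set g | g <> 1%g /\ word_length X g <= n%:R%:E]].

End DivisibilityFunction.

(* Only the values at positive integers matter. *)
Definition preceq (R : realType) (f1 f2 : nat -> \bar R) : Prop :=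
  exists C : nat, (0 < C)%N /\
    forall n : nat, (1 <= n)%N -> f1 n <= C%:R%:E * f2 (C * n)%N.

(* Main.v *)
(** A subgroup of index at most [t ^ 2] gives an action on its cosets, and a
    permutation of at most [t ^ 2] points has at most [2 t] distinct cycle
    lengths, so it is killed by some exponent [d <= t ^ (4 t)] (a crude form of
    Landau's bound).  Let [a], [b] be distinct elements of a free basis and
    [y_i = b^-i a^i b^i].  The balanced commutator of [y_1, ..., y_(2^n)] is
    nontrivial, because the [b^-i a b^i] are free generators, has length
    [O(8 ^ n)], and lies in the normal core of every subgroup containing in its
    core one of the powers [a^i], [i <= 2 ^ n].  With [t = 2 ^ m] and
    [2 ^ n = t ^ (4 t)] it lies in every subgroup of index at most [4 ^ m],
    whereas the logarithm of its length is only [O(m 2 ^ m)]. *)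

Require Import Defs.
From mathcomp Require Import all_boot all_order all_algebra.
From mathcomp Require Import perm.
From mathcomp Require Import all_classical all_reals all_analysis.
From mathcomp Require Import zify.

Set Implicit Arguments.
Unset Strict Implicit.
Unset Printing Implicit Defensive.

Import Order.TTheory GRing.Theory Num.Theory.

Section PermExponent.
Local Open Scope nat_scope.

Lemma uniq_size_sumn t (s : seq nat) :
  uniq s -> all (fun n => 0 < n) s -> sumn s <= t ^ 2 -> size s <= t.*2.
Proof.
move=> us s0 st; rewrite -(count_predC (leq^~ t) s) -addnn leq_add //.
  rewrite -size_filter -[leqRHS](size_iota 1) uniq_leq_size ?filter_uniq//.
  move=> x; rewrite mem_filter mem_iota add1n ltnS => /andP[-> xs].
  by have /= -> := allP s0 x xs.
case: t st => [|t] st.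
  have s1 : sumn s = 0 by lia.
  by move: (sumn_count (fun n => 0 < n) s) s0 s1; case: (s) => //= x s' _; lia.
have h : count (predC (leq^~ t.+1)) s * t.+1 <= sumn s.
  elim: (s) => //= x s' ih; rewrite mulnDl leq_add//.
  by case: ltnP => //=; lia.
by rewrite -(@leq_pmul2r t.+1)// (leq_trans h).
Qed.

Lemma sumn_undup_le (s : seq nat) : sumn (undup s) <= sumn s.
Proof. by elim: s => //= x s ih; case: ifP => _ /=; lia. Qed.

Lemma prod_leq_exp (s : seq nat) N :
  all (leq^~ N) s -> \prod_(n <- s) n <= N ^ size s.
Proof.
elim: s => [|x s ih] /=; first by rewrite big_nil.
by case/andP=> xN sN; rewrite big_cons expnS leq_mul ?ih.
Qed.

(* The product of the distinct cycle lengths kills [s]; they are at most [2 t]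
   in number, since their sum is at most [t ^ 2]. *)
Lemma perm_exponent (T : finType) (s : {perm T}) t : 0 < t -> #|T| <= t ^ 2 ->
  exists d, [/\ 0 < d, d <= t ^ (4 * t) & (s ^+ d)%g = 1%g].
Proof.
move=> t0 Tt.
pose L := undup [seq #|pred_of_set A| | A <- enum (porbits s)].
have memL x : #|porbit s x| \in L.
  by rewrite mem_undup; apply: map_f; rewrite mem_enum imset_f.
have L0 : all (fun n => 0 < n) L.
  apply/allP => n; rewrite mem_undup => /mapP[A].
  by rewrite mem_enum => /imsetP[x _ ->] -> /=; rewrite lt0n card_porbit_neq0.
have LT : all (leq^~ (t ^ 2)) L.
  apply/allP => n; rewrite mem_undup => /mapP[A _ ->].
  exact: leq_trans (max_card _) Tt.
have sumL : sumn L <= t ^ 2.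
  apply: leq_trans (sumn_undup_le _) _; apply: leq_trans Tt.
  rewrite sumnE big_map big_enum.
  rewrite -sum1_card (partition_big_imset (porbit s)) /= leq_eqVlt.
  apply/orP; left; apply/eqP; apply: eq_bigr => _ /imsetP[y _ ->].
  rewrite sum1_card; apply: eq_card => x.
  by rewrite -eq_porbit_mem [in RHS]unfold_in.
exists (\prod_(n <- L) n); split.
- by rewrite big_seq prodn_cond_gt0// => n nL; exact: (allP L0).
- apply: leq_trans (prod_leq_exp LT) _; rewrite -expnM leq_pexp2l//.
  have := uniq_size_sumn (undup_uniq _) L0 sumL; rewrite -/L; lia.
apply/permP => x; rewrite perm1 permX.
rewrite (big_rem _ (memL x)) /= mulnC iterM.
elim: (\prod_(y <- _) y) => //= n ->; exact: iter_porbit.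
Qed.

End PermExponent.

Section Words.
Local Open Scope group_scope.
Local Open Scope classical_set_scope.

Section Subgroup.
Variable G : groupType.
Implicit Types (g h x y : G) (D : set G).

Lemma subgroupP D : subgroup D <->
  D 1 /\ forall x y, D x -> D y -> D (x * y^-1).
Proof.
split=> [[D1 DB]|[D1 DB]].
  split; first exact: set_mem D1.
  by move=> x y /mem_set Dx /mem_set Dy; apply: set_mem; apply: DB.
split; first exact: mem_set.
by move=> x y /set_mem Dx /set_mem Dy; apply: mem_set; apply: DB.
Qed.

Lemma subgroup1 D : subgroup D -> D 1.
Proof. by case/subgroupP. Qed.

Lemma subgroupV D x : subgroup D -> D x -> D x^-1.
Proof. by case/subgroupP => D1 DB /(DB _ _ D1); rewrite mul1g. Qed.

Lemma subgroupM D x y : subgroup D -> D x -> D y -> D (x * y).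
Proof.
move=> DG Dx /(subgroupV DG) Dy; have [_ DB] := (subgroupP D).1 DG.
by rewrite -[y]invgK; apply: DB.
Qed.

Definition core D : set G := [set g | forall h, D (g ^ h)].

Lemma core_sub D : core D `<=` D.
Proof. by move=> g /(_ 1); rewrite conjg1. Qed.

Lemma coreR D g h : subgroup D -> core D g \/ core D h -> core D [~ g, h].
Proof.
move=> DG [cg|ch] x.
  rewrite commgEl conjMg conjVg -conjgM.
  by apply: subgroupM => //; apply: subgroupV.
rewrite commgEr conjMg -conjgM conjVg.
by apply: subgroupM => //; apply: subgroupV.
Qed.

Lemma coreJ D g x : core D g -> core D (g ^ x).
Proof. by move=> cg h; rewrite -conjgM. Qed.

Lemma has_index_labelling D k : subgroup D -> has_index D k ->
  exists (f : G -> 'I_k) (r : 'I_k -> G), cancel r f /\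
    forall g h, f g = f h <-> D (g^-1 * h).
Proof.
move=> DG /card_set_bijP[phi [phi_fun phi_inj phi_surj]].
pose cs g := (fun h => g * h) @` D.
have csL g : left_cosets D (cs g) by exists g.
pose f g : 'I_k := Ordinal (phi_fun _ (csL g)).
have fsurj (i : 'I_k) : exists g, f g = i.
  have [_ [g _ <-] gi] := phi_surj _ (ltn_ord i).
  by exists g; apply: val_inj.
have [r rf] := choice fsurj.
exists f, r; split=> // g h; split=> [/(congr1 val)/= fgh|Dgh].
  have /= cgh : cs g = cs h by apply: phi_inj fgh; apply: mem_set.
  have : cs h (h * 1) by exists 1 => //; exact: subgroup1.
  by rewrite -cgh => -[x Dx]; rewrite mulg1 => <-; rewrite mulKg.
apply: val_inj => /=; congr phi; apply/seteqP; split=> _ [x Dx <-].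
  exists (h^-1 * g * x); last by rewrite !mulgA mulgV mul1g.
  by apply: subgroupM => //; rewrite -[h^-1 * g]invgK invgM invgK;
    apply: subgroupV.
exists (g^-1 * h * x); last by rewrite !mulgA mulgV mul1g.
exact: subgroupM.
Qed.

Lemma core_expg D k t x : (0 < t)%N -> (k <= t ^ 2)%N ->
    subgroup D -> has_index D k ->
  exists d, [/\ (0 < d)%N, (d <= t ^ (4 * t))%N & core D (x ^+ d)].
Proof.
move=> t0 kt DG Dk; have [f [r [rK fP]]] := has_index_labelling DG Dk.
have s_inj : injective (fun i => f (x * r i)).
  move=> i j /fP; rewrite invgM mulgA mulgVK => /fP.
  by rewrite !rK.
pose s := perm s_inj.
have fs g : f (x * g) = s (f g).
  by rewrite permE; apply/fP; rewrite invgM mulgA mulgVK; apply/fP; rewrite rK.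
have fsn n g : f (x ^+ n * g) = (s ^+ n) (f g).
  elim: n => [|n ih]; first by rewrite mul1g perm1.
  by rewrite expgS -mulgA fs ih expgSr permM.
have [|d [d0 dt sd]] := @perm_exponent _ s t t0; first by rewrite card_ord.
exists d; split=> // g.
have /esym/fP : f (x ^+ d * g) = f g by rewrite fsn sd perm1.
by [].
Qed.

End Subgroup.

Definition inv_word T (s : seq (T * bool)) : seq (T * bool) :=
  [seq (l.1, ~~ l.2) | l <- rev s].

Lemma mem_inv_word (T : eqType) (l : T * bool) s :
  l \in inv_word s -> exists2 m, m \in s & l.1 = m.1.
Proof. by case/mapP => m; rewrite mem_rev => ms ->; exists m. Qed.

Section WordEval.
Variable G : groupType.
Implicit Types (g : G) (X B F : set G).

Lemma word_eval_nil : word_eval [::] = 1 :> G.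
Proof. by rewrite /word_eval big_nil. Qed.

Lemma word_eval_cons (l : G * bool) w :
  word_eval (l :: w) = (if l.2 then l.1^-1 else l.1) * word_eval w.
Proof. by rewrite /word_eval big_cons. Qed.

Lemma word_eval_cat (u v : seq (G * bool)) :
  word_eval (u ++ v) = word_eval u * word_eval v.
Proof. by rewrite /word_eval big_cat. Qed.

Lemma word_eval_nseq n (x : G) e :
  word_eval (nseq n (x, e)) = (if e then x^-1 else x) ^+ n.
Proof.
elim: n => [|n ih]; first exact: word_eval_nil.
by rewrite word_eval_cons ih expgS.
Qed.

Lemma word_eval_inv (w : seq (G * bool)) :
  word_eval (inv_word w) = (word_eval w)^-1.
Proof.
elim: w => [|l w ih]; first by rewrite word_eval_nil invg1.
rewrite /inv_word rev_cons map_rcons -cats1 word_eval_cat ih.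
rewrite !word_eval_cons word_eval_nil mulg1 invgM.
by case: (l.2) => //=; rewrite invgK.
Qed.

Lemma generatedP X g : generated X g ->
  exists w, word_over X w /\ word_eval w = g.
Proof.
pose E := [set g | exists w, word_over X w /\ word_eval w = g].
have EG : subgroup E.
  apply/subgroupP; split; first by exists [::]; rewrite word_eval_nil.
  move=> _ _ [u [uX <-]] [v [vX <-]].
  exists (u ++ inv_word v); split.
    by move=> l; rewrite mem_cat => /orP[/uX//|/mem_inv_word[m /vX + ->]].
  by rewrite word_eval_cat word_eval_inv.
apply: (smallest_sub EG) => x Xx; exists [:: (x, false)]; split.
  by move=> l; rewrite inE => /eqP ->.
by rewrite word_eval_cons word_eval_nil mulg1.
Qed.

Lemma subgroup_centralizer X : subgroup [set g | forall x, X x -> commute g x].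
Proof.
apply/subgroupP; split=> [x _|g h gX hX x Xx]; first exact/commute_sym/commute1.
apply: commute_sym; apply: commuteM; first exact/commute_sym/gX.
exact/commuteV/commute_sym/hX.
Qed.

Lemma generated_abelian B :
  (forall x y, B x -> B y -> commute x y) ->
  forall x y, generated B x -> generated B y -> commute x y.
Proof.
move=> cB x y Bx By.
have cFB z : generated B z -> forall u, B u -> commute z u.
  by apply: (smallest_sub (subgroup_centralizer B)) => v Bv u; exact: cB.
suff : [set g | forall u, generated B u -> commute g u] x by apply.
move: x Bx; apply: (smallest_sub (subgroup_centralizer _)) => v Bv u Bu.
exact/commute_sym/cFB.
Qed.

Lemma nonabelian_free_basis B F : free_basis B F -> nonabelian F ->
  exists a b, [/\ B a, B b & a != b].
Proof.
move=> [<- _] [x [y [Fx Fy xy]]]; apply: contrapT => nB; apply: xy.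
apply: (generated_abelian _ Fx Fy) => a b Ba Bb.
have [->//|ab] := eqVneq a b.
by case: nB; exists a, b.
Qed.

Lemma word_eval_expand X L w :
    (forall l, l \in w ->
      exists u, [/\ word_over X u, word_eval u = l.1 & (size u <= L)%N]) ->
  exists v, [/\ word_over X v, word_eval v = word_eval w &
    (size v <= size w * L)%N].
Proof.
elim: w => [|l w ih] wX; first by exists [::].
have [|v [vX vE vL]] := ih.
  by move=> m mw; apply: wX; rewrite inE mw orbT.
have [u [uX ul uL]] := wX l (mem_head _ _).
exists ((if l.2 then inv_word u else u) ++ v); split.
- move=> m; rewrite mem_cat => /orP[|/vX//].
  by case: (l.2) => [/mem_inv_word[m' /uX + ->]//|/uX].
- rewrite word_eval_cat word_eval_cons -ul -vE; congr (_ * _).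
  by case: (l.2); rewrite ?word_eval_inv.
- rewrite size_cat mulSn leq_add //.
  by case: (l.2); rewrite ?size_map ?size_rev.
Qed.

End WordEval.

Section BalancedCommutator.

Definition comm_word T (s t : seq (T * bool)) : seq (T * bool) :=
  inv_word s ++ inv_word t ++ s ++ t.

Fixpoint bal_comm n k : seq (nat * bool) :=
  if n is m.+1 then comm_word (bal_comm m k) (bal_comm m (k + 2 ^ m)%N)
  else [:: (k, false)].

Definition subst_word T U (y : T -> U) (s : seq (T * bool)) : seq (U * bool) :=
  [seq (y l.1, l.2) | l <- s].

Lemma word_eval_comm (G : groupType) (u v : seq (G * bool)) :
  word_eval (comm_word u v) = [~ word_eval u, word_eval v].
Proof.
by rewrite /comm_word !word_eval_cat !word_eval_inv commgEl conjgE.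
Qed.

Lemma subst_word_comm T U (y : T -> U) s t :
  subst_word y (comm_word s t) = comm_word (subst_word y s) (subst_word y t).
Proof.
by rewrite /subst_word /comm_word /inv_word !map_cat -!map_rev -!map_comp.
Qed.

Lemma size_bal_comm n k : size (bal_comm n k) = (4 ^ n)%N.
Proof.
elim: n k => //= n ih k.
by rewrite /comm_word /inv_word !size_cat !size_map !size_rev !ih expnS; lia.
Qed.

Lemma bal_comm_bounds n k (l : nat * bool) :
  l \in bal_comm n k -> (k <= l.1 < k + 2 ^ n)%N.
Proof.
elim: n k l => [|n ih] k l /=; first by rewrite inE => /eqP -> /=; lia.
rewrite /comm_word !mem_cat expnS.
case/or4P => [/mem_inv_word[m /ih + ->]|/mem_inv_word[m /ih + ->]|/ih|/ih];
  move: (_.1 : nat) => x; lia.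
Qed.

Lemma bal_comm_sorted n k :
  sorted (fun l m : nat * bool => l.1 != m.1) (bal_comm n k).
Proof.
set e := fun l m : nat * bool => _.
have e_cat s t u : t != [::] -> sorted e s -> sorted e (t ++ u) ->
    (forall l m, l \in s -> m \in t -> e l m) -> sorted e (s ++ t ++ u).
  case: s t => [|x s] [|y t] //= _ xs tu est.
  by rewrite cat_path xs /= tu est ?mem_last ?mem_head.
have e_inv s : sorted e s -> sorted e (inv_word s).
  rewrite /inv_word sorted_map rev_sorted; apply: sub_sorted => l m.
  by rewrite /e /= eq_sym.
elim: n k => //= n ih k.
have neq0 j : bal_comm n j != [::] by rewrite -size_eq0 size_bal_comm expn_eq0.
have inv_neq0 j : inv_word (bal_comm n j) != [::].
  by rewrite -size_eq0 size_map size_rev size_eq0.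
have disj (x y : nat) : (k <= x < k + 2 ^ n)%N ->
    (k + 2 ^ n <= y < k + 2 ^ n + 2 ^ n)%N -> x != y by lia.
rewrite /comm_word -[X in _ ++ _ ++ _ ++ X]cats0.
apply: (e_cat) => //; first exact: e_inv.
  apply: (e_cat) => //; first exact: e_inv.
    apply: (e_cat) => //; first by rewrite cats0.
    by move=> l m /bal_comm_bounds lk /bal_comm_bounds mk; exact: disj.
  move=> l m /mem_inv_word[l' /bal_comm_bounds lk ll'] /bal_comm_bounds mk.
  by rewrite /e ll' eq_sym; exact: disj.
move=> l m /mem_inv_word[l' /bal_comm_bounds lk ll'].
move=> /mem_inv_word[m' /bal_comm_bounds mk mm'].
by rewrite /e ll' mm'; exact: disj.
Qed.

End BalancedCommutator.

Section FreePair.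
Variables (G : groupType) (a b : G).

(* The reduced word in [a], [b] for [b^p] times the product of the
   [(indep i)^(+-1)]: between two consecutive factors, [b^i b^-j] is
   cancelled down to a power of [b]. *)
Fixpoint pair_word p (s : seq (nat * bool)) : seq (G * bool) :=
  if s is (i, e) :: s' then
    nseq (p - i) (b, false) ++ nseq (i - p) (b, true) ++
    nseq i (a, e) ++ pair_word i s'
  else nseq p (b, false).

Definition indep i : G := (a ^+ i) ^ (b ^+ i).

Lemma word_eval_pair p s :
  word_eval (pair_word p s) = b ^+ p * word_eval (subst_word indep s).
Proof.
elim: s p => [|[i e] s ih] p /=.
  by rewrite word_eval_nseq word_eval_nil mulg1.
rewrite !word_eval_cat !word_eval_nseq ih word_eval_cons /= !mulgA.
congr (_ * _); rewrite expVgn.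
have -> : b ^+ (p - i) * b ^- (i - p) = b ^+ p * b ^- i.
  case: (leqP i p) => [ip|/ltnW pi].
    by rewrite (eqP ip : i - p = 0)%N expg0 invg1 mulg1 expgnFr.
  by rewrite (eqP pi : p - i = 0)%N expg0 mul1g expgnFr // invgF.
by rewrite /indep conjgE; case: e; rewrite ?expVgn ?invgM ?invgK ?mulgA.
Qed.

Lemma pair_word_path l0 s : a != b ->
    path (fun l m : nat * bool => l.1 != m.1) l0 s ->
    all (fun l => 0 < l.1)%N s ->
  path (fun l m => ~~ ((l.1 == m.1) && (l.2 != m.2)))
    (a, l0.2) (pair_word l0.1 s).
Proof.
move=> ab; set r := fun l m : G * bool => _.
have rr l : r l l by rewrite /r !eqxx.
have rn n l : path r l (nseq n l) by elim: n => //= n ->; rewrite rr.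
have rl n x (l : G * bool) : last x (nseq n.+1 l) = l by elim: n x => //=.
have rab e e' : r (a, e) (b, e') by rewrite /r /= (negPf ab).
have rba e e' : r (b, e) (a, e') by rewrite /r /= eq_sym (negPf ab).
elim: s l0 => [|[i e] s ih] [p f] /=.
  by move=> _ _; case: p => //= p; rewrite rab rn.
case/andP=> pi ps /andP[i0 s0].
have {ih} ih := ih (i, e) ps s0.
have step n c : (0 < n)%N ->
    path r (a, f) (nseq n (b, c) ++ nseq i (a, e) ++ pair_word i s).
  case: n => // n _; case: i i0 ih {ps s0 pi} => // i _ ih.
  by rewrite !cat_path !rl /= rab rba !rn.
case: (ltngtP i p) pi => [ip _|ip _|->] //.
  by rewrite (eqP (ltnW ip) : i - p = 0)%N; apply: step; rewrite subn_gt0.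
by rewrite (eqP (ltnW ip) : p - i = 0)%N; apply: step; rewrite subn_gt0.
Qed.

Lemma pair_word_reduced s : a != b ->
    sorted (fun l m : nat * bool => l.1 != m.1) s ->
    all (fun l => 0 < l.1)%N s -> reduced (pair_word 0 s).
Proof.
move=> ab ss s0; apply: (path_sorted (x := (a, false))).
apply: (@pair_word_path (0, false)) => //.
by case: s ss s0 => //= l s -> /andP[l0 _]; rewrite eq_sym -lt0n l0.
Qed.

Lemma size_pair_word p s M : (p <= M)%N -> all (fun l => l.1 <= M)%N s ->
  (size (pair_word p s) <= (size s).*2.+1 * M)%N.
Proof.
elim: s p => [|[i e] s ih] p pM /=; first by rewrite size_nseq mul1n.
case/andP=> iM sM; rewrite !size_cat !size_nseq.
have := ih i iM sM; nia.
Qed.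

Lemma mem_pair_word p s l : l \in pair_word p s -> l.1 = a \/ l.1 = b.
Proof.
have nseqP n (m : G * bool) : l \in nseq n m -> l.1 = m.1.
  by rewrite mem_nseq => /andP[_ /eqP ->].
elim: s p => [|[i e] s ih] p /=; first by move/nseqP; right.
rewrite !mem_cat => /or4P[/nseqP|/nseqP|/nseqP|/ih//] /=; by [left|right].
Qed.

End FreePair.

Lemma core_bal_comm (G : groupType) (D : set G) (y : nat -> G) n k d :
    subgroup D -> (k <= d < k + 2 ^ n)%N -> core D (y d) ->
  core D (word_eval (subst_word y (bal_comm n k))).
Proof.
move=> DG + cd; elim: n k => [|n ih] k kd /=.
  have -> : k = d by lia.
  by rewrite word_eval_cons word_eval_nil mulg1.
rewrite subst_word_comm word_eval_comm; apply: coreR => //.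
rewrite expnS in kd.
have [dk|kd'] := ltnP d (k + 2 ^ n); [left|right]; apply: ih; lia.
Qed.

Lemma deep_element (G : groupType) (X B F : set G) :
    generated X = [set: G] -> free_basis B F -> nonabelian F ->
  exists2 L, (0 < L)%N & forall m, (0 < m)%N -> exists w,
    [/\ word_over X w, word_eval w <> 1,
        (size w <= 3 * 8 ^ (m * (4 * 2 ^ m)) * L)%N &
        forall D k, subgroup D -> has_index D k -> (k <= 4 ^ m)%N ->
          D (word_eval w)].
Proof.
move=> genX freeB nabF.
have [a [b [Ba Bb ab]]] := nonabelian_free_basis freeB nabF.
have gen g : exists w, word_over X w /\ word_eval w = g.
  by apply: generatedP; rewrite genX.
have [ua [uaX uaE]] := gen a; have [ub [ubX ubE]] := gen b.
exists (maxn (size ua) (size ub)).+1 => // m m0.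
set n := (m * (4 * 2 ^ m))%N; set s := bal_comm n 1.
have s_bnd (l : nat * bool) : l \in s -> (1 <= l.1 < 1 + 2 ^ n)%N.
  exact: bal_comm_bounds.
have s_pos : all (fun l : nat * bool => 0 < l.1)%N s.
  by apply/allP => l /s_bnd/andP[].
have s_le : all (fun l : nat * bool => l.1 <= 2 ^ n)%N s.
  by apply/allP => l /s_bnd/andP[_]; rewrite add1n ltnS.
have evalE :
    word_eval (pair_word a b 0 s) = word_eval (subst_word (indep a b) s).
  by rewrite word_eval_pair mul1g.
have [l|w [wX wE wL]] := @word_eval_expand _ X (maxn (size ua) (size ub)).+1
    (pair_word a b 0 s).
  by case/mem_pair_word => ->; [exists ua|exists ub]; split=> //;
    rewrite leqW// ?leq_maxl ?leq_maxr.
exists w; split=> //; rewrite ?wE.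
- apply: freeB.2; last 2 first.
  + exact: pair_word_reduced ab (bal_comm_sorted _ _) s_pos.
  + have : size s != 0%N by rewrite size_bal_comm expn_eq0.
    by case: s s_pos {s_bnd s_le evalE wE wL} => //= -[[//|i] e].
  + by move=> l /mem_pair_word[] ->.
- apply: leq_trans wL _; rewrite leq_mul2r /=.
  apply: leq_trans (size_pair_word a b (leq0n _) s_le) _.
  rewrite size_bal_comm (_ : 8 = 4 * 2)%N // expnMn mulnA leq_mul2r.
  by have := expn_gt0 4 n; lia.
move=> D k DG Dk km; rewrite evalE; apply: core_sub.
have t0 : (0 < 2 ^ m)%N by rewrite expn_gt0.
have [|d [d0 dt cd]] := core_expg a t0 _ DG Dk.
  by rewrite -expnM mulnC expnM.
apply: (core_bal_comm (d := d)) => //; last exact: coreJ.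
by rewrite d0 add1n ltnS (leq_trans dt)// -expnM.
Qed.

End Words.

Section Growth.
Local Open Scope nat_scope.

Lemma sqrn_lt_exp2 m : (m + 5) ^ 2 < 2 ^ (m + 5).
Proof.
elim: m => // m; rewrite addSn [2 ^ _.+1]expnS -!mulnn; move: (2 ^ _) => q; nia.
Qed.

Lemma exp2_dominates A : exists2 m, 0 < m & A * (m * 2 ^ m) < 4 ^ m.
Proof.
exists (A + 5); first by rewrite addnS.
rewrite (_ : 4 = 2 * 2) // expnMn mulnA ltn_mul2r expn_gt0 /=.
by apply: leq_trans (sqrn_lt_exp2 A); nia.
Qed.

End Growth.

Local Open Scope classical_set_scope.
Local Open Scope ring_scope.

Lemma ln_natr_le (R : realType) n k :
  (0 < n <= 2 ^ k)%N -> ln (n%:R : R) <= (2 * k)%:R.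
Proof.
case/andP=> n0 nk.
have n0R : (0 : R) < n%:R by rewrite ltr0n.
apply: (@le_trans _ _ (ln ((2 : R) ^+ k))).
  by rewrite ler_ln ?posrE ?exprn_gt0 // -natrX ler_nat.
rewrite lnXn // natrM mulr_natr lerMn2r; apply/orP; right.
exact/ltW/ln_sublinear.
Qed.

Theorem corollary5p1 (R : realType) (G : groupType) (X : set G)
    (finX : finite_set X) (genX : generated X = [set: G])
    (freeG : contains_nonabelian_free G) :
  ~ preceq (max_divisibility R X) (fun n : nat => (ln (n%:R : R))%:E).
Proof.
case: freeG => F [_ [B freeB] nabF] [C [C0 le_ln]].
have [L L0 deep] := deep_element genX freeB nabF.
have [m m0 mbig] := exp2_dominates (6 * C * (L * C + 4)).
have [w [wX w1 wL wD]] := deep m m0.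
set T := (m * (4 * 2 ^ m))%N in wL.
set N := (3 * 8 ^ T * L)%N in wL.
have N0 : (0 < N)%N by rewrite !muln_gt0 expn_gt0.
have lower : ((4 ^ m)%:R%:E <= max_divisibility R X N)%E.
  apply: (@le_trans _ _ (divisibility R (word_eval w))).
    apply: le_ereal_inf_tmp => _ [k [D [DG Dk Dw]] <-].
    rewrite lee_fin ler_nat leqNgt; apply/negP => /ltnW km.
    exact: Dw (wD D k DG Dk km).
  apply: ereal_sup_ubound; exists (word_eval w) => //; split=> //.
  apply: (@le_trans _ _ (size w)%:R%:E); last by rewrite lee_fin ler_nat.
  by apply: ereal_inf_lbound; exists w.
have upper : ln ((C * N)%:R : R) <= (2 * (3 * L * C + 3 * T))%:R.
  apply: ln_natr_le; rewrite muln_gt0 C0 N0 /= expnD [(2 ^ (3 * T))%N]expnM.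
  rewrite (_ : C * N = 3 * L * C * 8 ^ T)%N; last by rewrite /N; lia.
  exact: leq_mul (ltnW (ltn_expl _ _)) (leqnn _).
have := le_trans lower (le_ln N N0); rewrite -EFinM lee_fin.
move=> /le_trans/(_ (ler_wpM2l (ler0n R C) upper)).
rewrite -natrM ler_nat leqNgt => /negP; apply; apply: leq_ltn_trans mbig.
rewrite /T; have : (0 < 2 ^ m)%N by rewrite expn_gt0.
move: (2 ^ m)%N => q q0.
have : (0 < m * q)%N by rewrite muln_gt0 m0.
nia.
Qed.
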